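(* Let $\mathcal{A} = \mathcal{A}_1 \times \cdots \times \mathcal{A}_d$ be a product of finite nonempty sets, let $\Theta\subseteq\mathbb{R}^m$ be open, and for $\theta\in\Theta$ let $p_\theta(\mathbf{a}) = \prod_{i=1}^d p_\theta(a_i \mid \mathbf{a}_{i-1})$ be an autoregressive distribution on $\mathcal{A}$ whose conditional probabilities $p_\theta(a\mid\mathbf{a}_{i-1})$ are strictly positive and differentiable in $\theta$. If $\mathbf{a}$ is a sample from $p_\theta(\cdot)$, then $$\nabla_\theta \widetilde{H}_\theta(\mathbf{a}) + \sum_{i=1}^d H_\theta^{(i)}(\mathbf{a}_{i-1})\, \nabla_\theta \sum_{j=1}^{i-1} \log p_\theta(a_j\mid \mathbf{a}_{j-1})$$ is an unbiased estimator for the gradient of the entropy; that is, for every $\theta\in\Theta$, with $\mathbf{A}=(A_1,\dots,A_d)$ a random variable with distribution $p_\theta(\cdot)$, $$\mathrm{E}_{\mathbf{A}\sim p_\theta}\Big[\nabla_\theta \widetilde{H}_\theta(\mathbf{A}) + \sum_{i=1}^d H_\theta^{(i)}(\mathbf{A}_{i-1})\, \nabla_\theta \sum_{j=1}^{i-1} \log p_\theta(A_j\mid \mathbf{A}_{j-1})\Big] = \nabla_\theta H_\theta .$$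
   Context: For $\mathbf{a} = (a_1,\dots,a_d) \in \mathcal{A}$ write $\mathbf{a}_i = (a_1,\dots,a_i)$ for its prefix of length $i$ ($\mathbf{a}_0$ is the empty prefix); similarly $\mathbf{A}_i = (A_1,\dots,A_i)$. Autoregressive model: for each $i = 1,\dots,d$, each prefix $\mathbf{a}_{i-1} \in \mathcal{A}_1\times\cdots\times\mathcal{A}_{i-1}$ and each $\theta$, one is given a probability distribution $p_\theta(\cdot \mid \mathbf{a}_{i-1})$ on $\mathcal{A}_i$, and the joint distribution on $\mathcal{A}$ is defined by $p_\theta(\mathbf{a}) = \prod_{i=1}^d p_\theta(a_i\mid \mathbf{a}_{i-1})$. Exact entropy: $H_\theta = -\sum_{\mathbf{a}\in\mathcal{A}} p_\theta(\mathbf{a}) \log p_\theta(\mathbf{a})$. Smoothed entropy estimator: for $\mathbf{a}\in\mathcal{A}$, $$\widetilde{H}_\theta(\mathbf{a}) = \sum_{i=1}^d H_\theta^{(i)}(\mathbf{a}_{i-1}), \qquad H_\theta^{(i)}(\mathbf{a}_{i-1}) = -\sum_{a\in\mathcal{A}_i} p_\theta(a\mid \mathbf{a}_{i-1}) \log p_\theta(a\mid \mathbf{a}_{i-1}).$$ The gradient $\nabla_\theta$ is taken with respect to $\theta$ with the action arguments held fixed; an empty sum is $0$. The setting is a one-step decision problem, so the distribution $p_\theta$ is a single distribution on $\mathcal{A}$ (no state dynamics). *)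

(* Defs.v *)
From HB Require Import structures.
From mathcomp Require Import all_boot all_order all_algebra.
From mathcomp Require Import all_classical all_reals all_analysis.

Set Implicit Arguments.
Unset Strict Implicit.
Unset Printing Implicit Defensive.

Import Order.TTheory GRing.Theory Num.Theory.
Import numFieldNormedType.Exports.
Local Open Scope classical_set_scope.
Local Open Scope ring_scope.

Definition actions (d : nat) (A : 'I_d -> finType) := {dffun forall i : 'I_d, A i}.

(* Coordinates are numbered from 0, so the prefix preceding coordinate [i : 'I_d]
   has length [i] and consists of coordinates 0, ..., i - 1. *)
Definition prefixes (d : nat) (A : 'I_d -> finType) (i : 'I_d) :=
  {dffun forall j : 'I_i, A (widen_ord (ltnW (ltn_ord i)) j)}.

Definition prefix_of (d : nat) (A : 'I_d -> finType) (a : actions A) (i : 'I_d)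
    : prefixes A i :=
  [ffun j : 'I_i => a (widen_ord (ltnW (ltn_ord i)) j)].

(* [p theta i b x] is the conditional probability of the action [x] at
   coordinate [i] given the prefix [b]. As [p] is total in [theta], hypotheses
   on it are to be restricted to the parameter set. *)
Definition cond_family (R : realType) (m d : nat) (A : 'I_d -> finType) :=
  'rV[R]_m -> forall i : 'I_d, prefixes A i -> A i -> R.

Section Autoregressive.
Context (R : realType) (m d : nat) (A : 'I_d -> finType).
Implicit Types (p : cond_family R m A) (theta : 'rV[R]_m) (a : actions A).

Definition joint p theta a : R :=
  \prod_(i < d) p theta i (prefix_of a i) (a i).

Definition entropy p theta : R :=
  - \sum_(a : actions A) joint p theta a * ln (joint p theta a).

Definition cond_entropy p (i : 'I_d) (b : prefixes A i) theta : R :=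
  - \sum_(x : A i) p theta i b x * ln (p theta i b x).

Definition smoothed_entropy p a theta : R :=
  \sum_(i < d) cond_entropy p (prefix_of a i) theta.

Definition log_prefix_prob p a (i : 'I_d) theta : R :=
  \sum_(j < d | (j < i)%N) ln (p theta j (prefix_of a j) (a j)).

Definition gradient (f : 'rV[R]_m -> R) theta : 'rV[R]_m :=
  \row_(k < m) 'D_(delta_mx 0 k) f theta.

Definition entropy_grad_estimator p theta a : 'rV[R]_m :=
  gradient (smoothed_entropy p a) theta +
  \sum_(i < d) cond_entropy p (prefix_of a i) theta
                 *: gradient (log_prefix_prob p a i) theta.

End Autoregressive.

(* For a finite [T] equipped with its discrete sigma-algebra: the fibres generate
   it, so measurability and the law of [X] are determined by them. *)
Definition has_distribution (R : realType) (dsp : measure_display)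
    (Omega : measurableType dsp) (P : probability Omega R)
    (T : finType) (X : Omega -> T) (q : T -> R) : Prop :=
  forall t : T, measurable (X @^-1` [set t]) /\ P (X @^-1` [set t]) = (q t)%:E.

(* Main.v *)
(* Summing out the coordinates from the last one down gives the tower property: in
   a mean over the joint law, a function of coordinates 0, ..., i may be replaced by
   its conditional mean given the first i of them. Hence the entropy is the mean of
   the smoothed entropy H~ near theta, and differentiating gives
   grad H = E[grad H~ + H~ * sum_j grad ln p_j]. A term H^(i) * grad ln p_j with
   i <= j has mean 0: H^(i) is a function of the prefix preceding j, and given that
   prefix the score grad ln p_j has mean grad 1 = 0. Only the terms j < i remain. *)
Require Import Defs.
From HB Require Import structures.
From mathcomp Require Import all_boot all_order all_algebra.
From mathcomp Require Import all_classical all_reals all_analysis.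

Set Implicit Arguments.
Unset Strict Implicit.
Unset Printing Implicit Defensive.

Import Order.TTheory GRing.Theory Num.Theory.
Import numFieldNormedType.Exports.
Local Open Scope classical_set_scope.
Local Open Scope ring_scope.

(** * Overwriting one coordinate, and dependence on leading coordinates only *)

Section Update.
Context (d : nat) (A : 'I_d -> finType).
Implicit Types (a b : actions A) (i j k : 'I_d).

Definition update a k (x : A k) : actions A := [ffun j => eqtype.dfwith a x j].

Lemma update_in a k (x : A k) : update a x k = x.
Proof. by rewrite ffunE dfwith_in. Qed.

Lemma update_out a k (x : A k) j : k != j -> update a x j = a j.
Proof. by move=> kj; rewrite ffunE dfwith_out. Qed.

Lemma update_update a k (x y : A k) : update (update a x) y = update a y.
Proof.
apply/ffunP => j; have [<-|kj] := eqVneq k j; first by rewrite !update_in.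
by rewrite !update_out.
Qed.

Lemma update_id a k : update a (a k) = a.
Proof.
apply/ffunP => j; have [<-|kj] := eqVneq k j; first by rewrite update_in.
by rewrite update_out.
Qed.

(** Exchanging [x] with the coordinate [k] of [a] is an involution on pairs [(a, x)]; reindexing by
    it replaces [update a x] by [a], and the sum over [x] becomes constant. *)
Lemma sum_update (V : nmodType) k (F : actions A -> V) :
  \sum_(a : actions A) \sum_(x : A k) F (update a x) =
  \sum_(a : actions A) F a *+ #|A k|.
Proof.
under [RHS]eq_bigr do rewrite -sumr_const.
rewrite !pair_big /=.
pose h (u : actions A * A k) := (update u.1 u.2, u.1 k).
have hK : involutive h.
  by case=> a x; rewrite /h /= update_update update_id update_in.
rewrite (reindex h) /=; last exact/onW_bij/inv_bij.
by apply: eq_bigr => u _; rewrite update_update update_id.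
Qed.

Definition agree_below n a b := forall j, (j < n)%N -> a j = b j.

(** Stated on full action vectors, which avoids prefix types whose length varies with [n]. *)
Definition determined_below (T : Type) n (f : actions A -> T) :=
  forall a b, agree_below n a b -> f a = f b.

Lemma determined_belowW (T : Type) m n (f : actions A -> T) :
  (m <= n)%N -> determined_below m f -> determined_below n f.
Proof.
by move=> mn fm a b ab; apply: fm => j jm; apply: ab; apply: leq_trans mn.
Qed.

Lemma agree_below_update a k (x : A k) : agree_below k a (update a x).
Proof. by move=> j jk; rewrite update_out// -val_eqE gtn_eqF. Qed.

Lemma prefix_of_determined i : determined_below i (fun a => prefix_of a i).
Proof. by move=> a b ab; apply/ffunP => j; rewrite !ffunE; exact: (ab (widen_ord _ j) (ltn_ord j)). Qed.

Lemma prefix_of_update a k (x : A k) : prefix_of (update a x) k = prefix_of a k.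
Proof. exact/esym/(prefix_of_determined (agree_below_update a x)). Qed.

End Update.

(** * Summing out coordinates of the joint law *)

Section TowerProperty.
Context (R : realType) (m d : nat) (A : 'I_d -> finType).
Context (p : cond_family R m A) (theta : 'rV[R]_m).
Arguments p : clear implicits.
Hypothesis A_nonempty : forall i, (0 < #|A i|)%N.
Hypothesis p_sum1 :
  forall (i : 'I_d) (b : prefixes A i), \sum_(x : A i) p theta i b x = 1.
Implicit Types (a : actions A) (i j k : 'I_d).

(* Coordinates from n on are uniform. *)
Definition truncated_joint n a : R :=
  \prod_(j < d) if (j < n)%N then p theta j (prefix_of a j) (a j)
                else #|A j|%:R^-1.

Lemma truncated_joint_full a : truncated_joint d a = joint p theta a.
Proof. by apply: eq_bigr => j _; rewrite ltn_ord. Qed.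

(** Only the factor at [k] changes: the uniform weight becomes a conditional probability, and the
    factor [#|A k|] compensates. Earlier factors do not see coordinate [k]; later ones are
    constants. *)
Lemma truncated_joint_update a k (x : A k) :
  truncated_joint k.+1 (update a x) =
  #|A k|%:R * (truncated_joint k a * p theta k (prefix_of a k) x).
Proof.
rewrite /truncated_joint (bigD1 k)//= [in RHS](bigD1 k)//= ltnSn ltnn.
rewrite update_in prefix_of_update.
rewrite mulrC [RHS]mulrA [X in _ = X * _]mulrA mulfV ?pnatr_eq0 -?lt0n// mul1r.
congr (_ * _); apply: eq_bigr => j jk.
rewrite ltnS leq_eqVlt val_eqE (negPf jk) /=.
case: ifP => // ltjk; rewrite update_out 1?eq_sym//.
rewrite (_ : prefix_of (update a x) j = prefix_of a j)//; apply/esym.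
exact: (determined_belowW (ltnW ltjk) (@prefix_of_determined _ _ j)
  (agree_below_update a x)).
Qed.

Lemma sum_truncated_jointS k (f : actions A -> R) :
  \sum_a truncated_joint k.+1 a * f a =
  \sum_a truncated_joint k a *
    \sum_(x : A k) p theta k (prefix_of a k) x * f (update a x).
Proof.
have Ak0 : #|A k|%:R != 0 :> R by rewrite pnatr_eq0 -lt0n.
apply: (mulfI Ak0); rewrite mulr_natl -sumrMnl.
rewrite -(sum_update k (fun a => truncated_joint k.+1 a * f a)) mulr_sumr.
apply: eq_bigr => a _; rewrite !mulr_sumr; apply: eq_bigr => x _.
by rewrite truncated_joint_update !mulrA.
Qed.

(** Going down from the last coordinate to [n], [f] does not see the coordinate being summed out,
    and its conditional probabilities sum to 1. *)
Lemma sum_joint_determined n (f : actions A -> R) : (n <= d)%N ->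
  determined_below n f ->
  \sum_a joint p theta a * f a = \sum_a truncated_joint n a * f a.
Proof.
move=> nd fn; under eq_bigr do rewrite -truncated_joint_full.
(* Here [e] counts the coordinates from [n] on that still carry their conditional law; the inductive
   step makes coordinate [n + e] uniform. *)
suff H e : (e <= d - n)%N ->
    \sum_a truncated_joint (n + e) a * f a = \sum_a truncated_joint n a * f a.
  by rewrite -(H _ (leqnn _)) subnKC.
elim: e => [|e IHe] ed; first by rewrite addn0.
rewrite addnS.
have ltd : (n + e < d)%N by rewrite -ltn_subRL.
rewrite -IHe ?(ltnW ed)//.
have -> := sum_truncated_jointS (Ordinal ltd) f.
apply: eq_bigr => a _ /=; congr (_ * _).
have fne := determined_belowW (leq_addr e n) fn.
under eq_bigr => x _ do rewrite -(fne _ _ (agree_below_update a x)).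
by rewrite -mulr_suml p_sum1 mul1r.
Qed.

(** Truncate the law after coordinate [i], sum that coordinate out, then restore the joint law: the
    conditional mean is determined below [i], because [update] overwrites coordinate [i]. *)
Lemma tower_property i (f : actions A -> R) : determined_below i.+1 f ->
  \sum_a joint p theta a * f a =
  \sum_a joint p theta a *
    \sum_(x : A i) p theta i (prefix_of a i) x * f (update a x).
Proof.
move=> fi; rewrite (sum_joint_determined (ltn_ord i) fi) sum_truncated_jointS.
rewrite -sum_joint_determined 1?ltnW//= => a b ab.
rewrite (prefix_of_determined ab); apply: eq_bigr => x _; congr (_ * _).
apply: fi => j; rewrite ltnS leq_eqVlt => /orP[/eqP/val_inj->|ji].
  by rewrite !update_in.
by rewrite !update_out ?ab// -val_eqE gtn_eqF.
Qed.

Lemma sum_joint_coordinate i (g : prefixes A i -> A i -> R) :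
  \sum_a joint p theta a * g (prefix_of a i) (a i) =
  \sum_a joint p theta a *
    \sum_(x : A i) p theta i (prefix_of a i) x * g (prefix_of a i) x.
Proof.
rewrite (@tower_property i (fun a => g (prefix_of a i) (a i))); last first.
  move=> a b ab; rewrite (ab i)//; congr (g _ _).
  by apply: prefix_of_determined => j ji; apply: ab; exact: ltnW.
apply: eq_bigr => a _; congr (_ * _); apply: eq_bigr => x _.
by rewrite prefix_of_update update_in.
Qed.

End TowerProperty.

(** * Directional derivatives of logarithms, finite sums and products *)

Section Derivatives.
Context (R : realType) (V : normedModType R).
Implicit Types (x v : V).

(** Both difference quotients are the same function of [h]; this makes the one-variable chain rule
    available. *)
Lemma is_derive_line (f : V -> R) x v df :
  is_derive x v f df <-> is_derive (0 : R) 1 (fun h => f (h *: v + x)) df.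
Proof.
have E : (fun h : R => h^-1 *: ((f \o shift x) (h *: v) - f x)) =
    (fun h : R => h^-1 *: (((fun h => f (h *: v + x)) \o shift 0) (h *: 1) -
      f (0 *: v + x))).
  by apply/funext => h /=; rewrite addr0 scale0r add0r /GRing.scale /= mulr1.
by split=> -[dfx dfE]; split; move: dfx dfE; rewrite /derivable /derive E.
Qed.

Lemma is_derive_ln (f : V -> R) x v df : 0 < f x ->
  is_derive x v f df -> is_derive x v (fun y => ln (f y)) (df / f x).
Proof.
move=> fx0 /is_derive_line fl; apply/is_derive_line; rewrite mulrC.
apply: (@is_derive1_comp _ (@ln R) (fun h : R => f (h *: v + x))) => //.
have -> : f x = f (0 *: v + x) by rewrite scale0r add0r.
by apply: is_derive1_ln; rewrite scale0r add0r.
Qed.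

Lemma is_derive_sum_cond (I : finType) (P : pred I) (f : I -> V -> R) x v
    (df : I -> R) :
  (forall i, P i -> is_derive x v (f i) (df i)) ->
  is_derive x v (fun y => \sum_(i | P i) f i y) (\sum_(i | P i) df i).
Proof.
move=> fdf; rewrite (_ : (fun _ => _) = \sum_(i | P i) f i); last first.
  by apply/funext => y; rewrite fct_sumE.
by elim/big_ind2 : _ => // [|? ? ? ?]; [exact: is_derive_cst|exact: is_deriveD].
Qed.

(** The logarithmic form of the product rule makes the score appear directly when applied to
    [joint]. *)
Lemma is_derive_prod (I : finType) (f : I -> V -> R) x v (df : I -> R) :
  (forall i, f i x != 0) -> (forall i, is_derive x v (f i) (df i)) ->
  is_derive x v (fun y => \prod_i f i y)
    ((\prod_i f i x) * \sum_i df i / f i x).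
Proof.
move=> f0 fdf; elim: (index_enum I) => [|i s IHs].
  under eq_fun do rewrite big_nil.
  by rewrite !big_nil mulr0; exact: is_derive_cst.
under eq_fun do rewrite big_cons.
apply: is_derive_eq; rewrite !big_cons /GRing.scale /=.
rewrite mulrDr addrC [X in _ + X = _]mulrA; congr (_ + _).
by rewrite [f i x * _]mulrC -mulrA [f i x * _]mulrC divfK.
Qed.

End Derivatives.

(** [g (X w)] is a finite combination of indicators of the fibres of [X], integrated term by
    term. *)
Lemma expectation_finite (R : realType) (dsp : measure_display)
    (Omega : measurableType dsp) (P : probability Omega R) (T : finType)
    (X : Omega -> T) (q g : T -> R) :
  has_distribution P X q ->
  ('E_P[fun w => (g (X w))%R])%E = (\sum_t q t * g t)%:E.
Proof.
move=> Xq; rewrite unlock /=.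
under eq_integral => w _.
  rewrite (_ : (g (X w))%:E =
      (\sum_t (g t)%:E * (\1_(X @^-1` [set t]) w)%:E)%E); last first.
    rewrite (bigD1 (X w))//= indicE mem_set// mule1 big1 ?adde0// => t tX.
    rewrite indicE memNset ?mule0//= => Xw.
    by move: tX; rewrite -Xw eqxx.
  over.
have indI t : P.-integrable setT (fun w => (\1_(X @^-1` [set t]) w)%:E).
  by apply: integrable_indic; exact: (Xq t).1.
rewrite integral_sum//=; last by move=> t; apply: integrableZl.
rewrite -sumEFin; apply: eq_bigr => t _.
rewrite integralZl// integral_indic//; last exact: (Xq t).1.
by rewrite setIT EFinM muleC; congr (_ * _)%E; exact: (Xq t).2.
Qed.

(** * The entropy as a mean, and the vanishing of centred scores *)

Section EntropyGradient.
Context (R : realType) (m d : nat) (A : 'I_d -> finType).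
Context (p : cond_family R m A) (theta : 'rV[R]_m).
Arguments p : clear implicits.
Hypothesis A_nonempty : forall i, (0 < #|A i|)%N.
Hypothesis p_gt0 :
  forall (i : 'I_d) (b : prefixes A i) (x : A i), 0 < p theta i b x.
Hypothesis p_sum1 :
  forall (i : 'I_d) (b : prefixes A i), \sum_(x : A i) p theta i b x = 1.

Lemma ln_joint (a : actions A) :
  ln (joint p theta a) = \sum_i ln (p theta i (prefix_of a i) (a i)).
Proof.
(* Positivity is carried through the induction, since [lnM] needs both factors positive. *)
rewrite /joint; suff [] : 0 < \prod_(i < d) p theta i (prefix_of a i) (a i) /\
  ln (\prod_(i < d) p theta i (prefix_of a i) (a i)) =
  \sum_i ln (p theta i (prefix_of a i) (a i)) by [].
elim/big_ind2 : _ => [|x1 x2 y1 y2 [x0 <-] [y0 <-]|i _] //; first by rewrite ln1.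
by rewrite mulr_gt0// lnM.
Qed.

(** The chain rule for entropy: the logarithm splits over coordinates, and averaging the term at [i]
    given its prefix yields [cond_entropy]. *)
Lemma entropy_mean_smoothed :
  entropy p theta = \sum_a joint p theta a * smoothed_entropy p a theta.
Proof.
rewrite /entropy /smoothed_entropy -sumrN.
under eq_bigr => a _ do rewrite ln_joint -mulrN -sumrN mulr_sumr.
under [RHS]eq_bigr do rewrite mulr_sumr.
rewrite exchange_big [RHS]exchange_big /=; apply: eq_bigr => i _.
rewrite (sum_joint_coordinate A_nonempty p_sum1
  (fun b x => - ln (p theta i b x))).
apply: eq_bigr => a _; congr (_ * _); rewrite /cond_entropy -sumrN.
by apply: eq_bigr => x _; rewrite mulrN.
Qed.

(** As [i <= j], the factor [c] is unchanged when coordinate [j] is resampled, so it leaves the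
    conditional mean of [s], which is 0. *)
Lemma sum_joint_score_eq0 (i j : 'I_d) (c : prefixes A i -> R)
    (s : prefixes A j -> A j -> R) : (i <= j)%N ->
  (forall b, \sum_(x : A j) p theta j b x * s b x = 0) ->
  \sum_a joint p theta a * (c (prefix_of a i) * s (prefix_of a j) (a j)) = 0.
Proof.
move=> ij s0.
have cj n : (j <= n)%N -> determined_below n (fun a => c (prefix_of a i)).
  move=> jn a b ab; congr c; apply: prefix_of_determined => k ki.
  by apply: ab; apply: leq_trans ki (leq_trans ij jn).
rewrite (@tower_property _ _ _ _ _ _ A_nonempty p_sum1 j); last first.
  move=> a b ab; rewrite (cj _ _ _ _ ab)// (ab j)//.
  congr (_ * s _ _).
  by apply: prefix_of_determined => k kj; apply: ab; exact: ltnW.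
rewrite big1// => a _.
transitivity (joint p theta a * (c (prefix_of a i) *
    \sum_(x : A j) p theta j (prefix_of a j) x * s (prefix_of a j) x)); last by rewrite s0 !mulr0.
congr (_ * _); rewrite mulr_sumr; apply: eq_bigr => x _; rewrite mulrCA prefix_of_update update_in.
by rewrite -(cj j (leqnn _) _ _ (agree_below_update a x)).
Qed.

End EntropyGradient.

Theorem theorem4 (R : realType) (m d : nat) (A : 'I_d -> finType)
    (Theta : set 'rV[R]_m) (p : cond_family R m A)
    (A_nonempty : forall i : 'I_d, (0 < #|A i|)%N)
    (Theta_open : open Theta)
    (p_gt0 : forall theta, Theta theta ->
       forall (i : 'I_d) (b : prefixes A i) (x : A i), 0 < p theta i b x)
    (p_sum1 : forall theta, Theta theta ->
       forall (i : 'I_d) (b : prefixes A i), \sum_(x : A i) p theta i b x = 1)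
    (p_diff : forall theta, Theta theta ->
       forall (i : 'I_d) (b : prefixes A i) (x : A i),
         differentiable (fun t : 'rV[R]_m => p t i b x) theta)
    (theta : 'rV[R]_m) (theta_in : Theta theta)
    (dsp : measure_display) (Omega : measurableType dsp)
    (P : probability Omega R) (X : Omega -> actions A)
    (X_law : has_distribution P X (joint p theta)) :
  forall k : 'I_m,
    ('E_P[fun w => (entropy_grad_estimator p theta (X w) 0 k)%R])%E =
    (gradient (entropy p) theta 0 k)%:E.
Proof.
move=> k.
rewrite (expectation_finite (fun a => entropy_grad_estimator p theta a 0 k) X_law).
congr EFin.
pose v : 'rV[R]_m := delta_mx 0 k.
pose dp i b x : R := 'D_v (fun t => p t i b x) theta.
pose score (a : actions A) j : R :=
  dp j (prefix_of a j) (a j) / p theta j (prefix_of a j) (a j).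
have pD i b x : is_derive theta v (fun t => p t i b x) (dp i b x).
  exact/derivableP/diff_derivable/p_diff.
have lnD i b x :
    is_derive theta v (fun t => ln (p t i b x)) (dp i b x / p theta i b x).
  by apply: is_derive_ln => //; exact: p_gt0.
(* Only differentiability matters here: the derivatives of the entropies occur on both sides and
   cancel unevaluated. *)
have cond_entropyD i (b : prefixes A i) :
    is_derive theta v (cond_entropy p b) ('D_v (cond_entropy p b) theta).
  apply: derivableP; apply: derivableN; apply: ex_derive.
  by apply: is_derive_sum_cond => x _; exact: (is_deriveM (pD i b x) (lnD i b x)).
have HD a :
    is_derive theta v (smoothed_entropy p a) ('D_v (smoothed_entropy p a) theta).
  apply: derivableP; apply: ex_derive.
  by apply: is_derive_sum_cond => i _; exact: cond_entropyD.
have logD a i :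
    'D_v (log_prefix_prob p a i) theta = \sum_(j < d | (j < i)%N) score a j.
  by apply: derive_val; exact: is_derive_sum_cond.
have jointD a :
    is_derive theta v (fun t => joint p t a)
      (joint p theta a * \sum_j score a j).
  by apply: is_derive_prod => // i; rewrite gt_eqF// p_gt0.
have entropyD : 'D_v (entropy p) theta =
    \sum_a (joint p theta a * 'D_v (smoothed_entropy p a) theta +
      smoothed_entropy p a theta * (joint p theta a * \sum_j score a j)).
  transitivity
      ('D_v (fun t => \sum_a joint p t a * smoothed_entropy p a t) theta).
    (* The two functions agree on the open set [Theta], hence near [theta], so their derivatives
       agree. *)
    apply: near_eq_derive; have := open_nbhs_nbhs (conj Theta_open theta_in).
    apply: filterS => t tT; apply: entropy_mean_smoothed => // *.
      exact: p_gt0.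
    exact: p_sum1.
  apply: derive_val; apply: is_derive_sum_cond => a _.
  exact: (is_deriveM (jointD a) (HD a)).
have estimatorE a : entropy_grad_estimator p theta a 0 k =
    'D_v (smoothed_entropy p a) theta +
    \sum_i cond_entropy p (prefix_of a i) theta *
      \sum_(j < d | (j < i)%N) score a j.
  rewrite !mxE summxE; congr (_ + _).
  by apply: eq_bigr => i _; rewrite !mxE logD.
rewrite [RHS]mxE entropyD; under eq_bigr do rewrite estimatorE mulrDr.
rewrite !big_split /=; congr (_ + _); apply/eqP;
  rewrite eq_sym -subr_eq0; apply/eqP.
rewrite -sumrB.
(* Entropy gradient minus mean estimator: the full score sum loses its terms [j < i], leaving the
   pairs with [i <= j]. *)
transitivity (\sum_a \sum_(i < d) \sum_(j < d | ~~ (j < i)%N)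
    joint p theta a * (cond_entropy p (prefix_of a i) theta * score a j)).
  apply: eq_bigr => a _; rewrite mulrCA -mulrBr /smoothed_entropy mulr_suml -sumrB mulr_sumr.
  apply: eq_bigr => i _; rewrite -mulrBr (bigID (fun j : 'I_d => (j < i)%N)) /=.
  by rewrite addrAC subrr add0r !mulr_sumr.
rewrite exchange_big big1//= => i _; rewrite exchange_big big1//= => j.
rewrite -leqNgt => ij.
apply: (@sum_joint_score_eq0 _ _ _ _ _ _ A_nonempty (p_sum1 _ theta_in) i j
  (fun b => cond_entropy p b theta) (fun b x => dp j b x / p theta j b x) ij) => b.
(* The conditional probabilities sum to 1 around [theta], so their derivatives sum to 0. *)
transitivity ('D_v (fun t => \sum_x p t j b x) theta).
  under eq_bigr => x _ do rewrite mulrC divfK ?gt_eqF ?p_gt0//.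
  by apply/esym/derive_val; exact: is_derive_sum_cond.
transitivity ('D_v (cst (1 : R)) theta); last exact: derive_cst.
apply: near_eq_derive; have := open_nbhs_nbhs (conj Theta_open theta_in).
by apply: filterS => t tT; exact: p_sum1.
Qed.
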